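(* Let $k\ge 0$ be an integer. Every $(k+1)$-regular graph with less than $\frac{4}{3}(k+2)$ vertices is in $\widehat{\mathcal{D}}_k$. Moreover, for every $k\equiv 1\pmod 3$ there is a $(k+1)$-regular graph on $\frac{4}{3}(k+2)$ vertices that is not in $\widehat{\mathcal{D}}_k$.
   Context: All graphs are undirected, simple, finite and non-empty. A graph $H$ is a minor of $G$ if a graph isomorphic to $H$ can be obtained from $G$ by a sequence of edge contractions, edge deletions and vertex deletions (after a contraction, parallel edges are replaced by a single edge). $\delta(G)$ is the minimum degree of $G$. $\mathcal{D}_k$ is the class of graphs $G$ such that every minor of $G$ has minimum degree at most $k$. $\widehat{\mathcal{D}}_k$ is the set of minimal forbidden minors of $\mathcal{D}_k$: the graphs $G\notin\mathcal{D}_k$ such that every proper minor of $G$ is in $\mathcal{D}_k$. *)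

(* Defs.v *)
From mathcomp Require Import all_boot.
From Stdlib Require Import Relation_Operators.

Set Implicit Arguments.
Unset Strict Implicit.
Unset Printing Implicit Defensive.

Record sgraph := SGraph {
  vertex :> finType;
  adj : rel vertex;
  adj_sym : symmetric adj;
  adj_irrefl : irreflexive adj;
  vertex_nonempty : 0 < #|vertex| }.

Arguments adj {s}.

Definition giso (G H : sgraph) : Prop :=
  exists2 f : G -> H, bijective f & forall x y, adj (f x) (f y) = adj x y.

Definition deg (G : sgraph) (x : G) : nat := #|[set y | adj x y]|.

Definition regular (d : nat) (G : sgraph) : Prop := forall x : G, deg x = d.

(* A degree in G is smaller than #|G| and G is non-empty, so the default value
   #|G| never affects the minimum. *)
Definition min_deg (G : sgraph) : nat := \big[minn/#|G|]_(x : G) deg x.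

Section Operations.

Variable G : sgraph.

Section EdgeDeletion.

Variables u v : G.

Definition del_edge_adj : rel G :=
  fun x y => adj x y && ([set x; y] != [set u; v]).

Lemma del_edge_sym : symmetric del_edge_adj.
Proof. by move=> x y; rewrite /del_edge_adj adj_sym setUC. Qed.

Lemma del_edge_irrefl : irreflexive del_edge_adj.
Proof. by move=> x; rewrite /del_edge_adj adj_irrefl. Qed.

Definition del_edge : sgraph :=
  SGraph del_edge_sym del_edge_irrefl (vertex_nonempty G).

End EdgeDeletion.

Section VertexDeletion.

Variables (v : G) (G_gt1 : 1 < #|G|).

Definition del_vertex_adj : rel {x : G | x != v} :=
  fun x y => adj (val x) (val y).

Lemma del_vertex_sym : symmetric del_vertex_adj.
Proof. by move=> x y; rewrite /del_vertex_adj adj_sym. Qed.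

Lemma del_vertex_irrefl : irreflexive del_vertex_adj.
Proof. by move=> x; rewrite /del_vertex_adj adj_irrefl. Qed.

Lemma del_vertex_nonempty : 0 < #|{: {x : G | x != v}}|.
Proof. by rewrite card_sig cardC1 -subn1 subn_gt0. Qed.

Definition del_vertex : sgraph :=
  SGraph del_vertex_sym del_vertex_irrefl del_vertex_nonempty.

End VertexDeletion.

Section EdgeContraction.

Variables (u v : G) (uv : adj u v).

(* The vertex u plays the role of the vertex obtained by identifying u and v;
   the boolean relation merges parallel edges, and x != y drops the loop. *)
Definition contract_adj : rel {x : G | x != v} :=
  fun x y => (x != y) &&
    [|| adj (val x) (val y),
        (val x == u) && adj v (val y) |
        (val y == u) && adj v (val x)].

Lemma contract_sym : symmetric contract_adj.
Proof.
by move=> x y; rewrite /contract_adj eq_sym adj_sym; congr (_ && (_ || _)); rewrite orbC.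
Qed.

Lemma contract_irrefl : irreflexive contract_adj.
Proof. by move=> x; rewrite /contract_adj eqxx. Qed.

Lemma contract_nonempty : 0 < #|{: {x : G | x != v}}|.
Proof.
have u_neq_v : u != v by apply: contraTneq uv => ->; rewrite adj_irrefl.
by apply/card_gt0P; exists (Sub u u_neq_v).
Qed.

Definition contract : sgraph :=
  SGraph contract_sym contract_irrefl contract_nonempty.

End EdgeContraction.

End Operations.

Inductive minor_step (G : sgraph) : sgraph -> Prop :=
| StepDelEdge (u v : G) of adj u v : minor_step G (del_edge u v)
| StepDelVertex (v : G) (G_gt1 : 1 < #|G|) : minor_step G (del_vertex v G_gt1)
| StepContract (u v : G) (uv : adj u v) : minor_step G (contract uv).

Definition minor (H G : sgraph) : Prop :=
  exists2 H', clos_refl_trans_1n sgraph minor_step G H' & giso H H'.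

Definition proper_minor (H G : sgraph) : Prop := minor H G /\ ~ giso H G.

Definition classD (k : nat) (G : sgraph) : Prop :=
  forall H, minor H G -> min_deg H <= k.

Definition minimal_forbidden (k : nat) (G : sgraph) : Prop :=
  ~ classD k G /\ forall H, proper_minor H G -> classD k H.

(* Main.v *)
(* A minor H of G is witnessed by branch sets, encoded as a partial map from G
   onto H.  If H has minimum degree at least k+1 and x is alone in its branch
   set, then the k+1 neighbours of x lie in pairwise distinct branch sets, and
   none of them is deleted.  Hence, if some branch set contains an edge uv, then
   u, v and their at least 2k+2-n common neighbours all lie outside the set of
   such x; but at most 2(n-|H|) <= 2(n-k-2) vertices do, so 3n >= 4(k+2).
   Otherwise H is a subgraph closed under neighbours, and G is connected because
   n < 2(k+2), so H is isomorphic to G.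

   For k+2 = 3p, equality in this count is attained by the complement of two
   disjoint copies of K_{p,p}, which contracts to K_{3p}: the lone vertices form
   one part of each copy, and the other two parts are matched and contracted. *)
Require Import Defs.
From mathcomp Require Import all_boot zify.
From Stdlib Require Import Relation_Operators.

Set Implicit Arguments.
Unset Strict Implicit.
Unset Printing Implicit Defensive.

(** * Minimum degree *)

Lemma min_deg_leq (G : sgraph) (x : G) : min_deg G <= deg x.
Proof.
rewrite /min_deg; elim: (index_enum G) (mem_index_enum x) => // y s IH.
rewrite inE big_cons geq_min => /orP[/eqP->|/IH ->]; first by rewrite leqnn.
by rewrite orbT.
Qed.

Lemma deg_lt_card (G : sgraph) (x : G) : deg x < #|G|.
Proof.
rewrite /deg -cardsT; apply: proper_card; apply/properP; split; first exact: subsetT.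
by exists x; rewrite ?inE // adj_irrefl.
Qed.

Lemma leq_min_deg (d : nat) (G : sgraph) :
  (forall x : G, d <= deg x) -> d <= min_deg G.
Proof.
move=> ge_d; rewrite /min_deg; elim/big_ind: _ => //.
(* The default value [#|G|] exceeds the degree of any vertex, and some vertex exists. *)
- have /card_gt0P[x _] := vertex_nonempty G.
  exact: leq_trans (ge_d x) (ltnW (deg_lt_card x)).
- by move=> a b le_a le_b; rewrite leq_min le_a.
Qed.

(** * Isomorphisms and models of minors *)

Lemma giso_sym (G H : sgraph) : giso G H -> giso H G.
Proof.
case=> f [g fK gK] f_adj; exists g; first by exists f.
by move=> x y; rewrite -f_adj !gK.
Qed.

(* The vertices mapped to None are deleted.  Branch sets need not be connected:
   it is enough that those with two vertices contain an edge, and this weaker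
   property is preserved by composition. *)
Record model (G H : sgraph) (phi : G -> option H) : Prop := Model {
  model_surj : forall h, exists x, phi x = Some h;
  model_adj : forall h h', adj h h' ->
    exists x y, [/\ phi x = Some h, phi y = Some h' & adj x y];
  model_branch : forall x y h, x != y -> phi x = Some h -> phi y = Some h ->
    exists u v, [/\ phi u = Some h, phi v = Some h & adj u v] }.

(** Two vertices of a composite branch set either share a branch set of [phi] or have distinct
    images in [G1]; in the latter case [psi] provides an edge of [G1], which lifts to [G]. *)
Lemma model_comp (G G1 H : sgraph) (phi : G -> option G1) (psi : G1 -> option H) :
  model phi -> model psi -> model (fun x => obind psi (phi x)).
Proof.
move=> [surj1 adj1 br1] [surj2 adj2 br2]; split.
- move=> h; have [w psiw] := surj2 h; have [x phix] := surj1 w.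
  by exists x; rewrite phix.
- move=> h h' /adj2[w [w' [psiw psiw' /adj1[x [y [phix phiy xy]]]]]].
  by exists x, y; rewrite phix phiy.
- move=> x y h xNy; case phix: (phi x) => [w|] //= psiw.
  case phiy: (phi y) => [w'|] //= psiw'.
  have [eq_w|wNw'] := eqVneq w w'.
    rewrite -eq_w in phiy; have [u [v [phiu phiv uv]]] := br1 _ _ _ xNy phix phiy.
    by exists u, v; rewrite phiu phiv.
  have [a [b [psia psib /adj1[u [v [phiu phiv uv]]]]]] := br2 _ _ _ wNw' psiw psiw'.
  by exists u, v; rewrite phiu phiv.
Qed.

Lemma model_giso (G H : sgraph) : giso H G -> exists phi : G -> option H, model phi.
Proof.
case=> f [g fK gK] f_adj; exists (fun x => Some (g x)); split.
- by move=> h; exists (f h); rewrite fK.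
- by move=> h h' hh'; exists (f h), (f h'); rewrite !fK f_adj.
- by move=> x y h xNy [<-] [/(can_inj gK) eq_xy]; rewrite eq_xy eqxx in xNy.
Qed.

Lemma model_minor_step (G H : sgraph) :
  minor_step G H -> exists phi : G -> option H, model phi.
Proof.
case=> [u v uv|v G_gt1|u v uv].
- exists (fun x => Some x); split.
  + by move=> h; exists h.
  + by move=> h h' /andP[hh' _]; exists h, h'.
  + by move=> x y h xNy [<-] [eq_xy]; rewrite eq_xy eqxx in xNy.
- exists insub; split.
  + by move=> h; exists (val h); rewrite valK.
  + by move=> h h' hh'; exists (val h), (val h'); rewrite !valK.
  + move=> x y h xNy; case: insubP => // a _ aE [ah]; case: insubP => // b _ bE [bh].
    by rewrite -aE -bE ah bh eqxx in xNy.
- have uNv : u != v by apply: contraTneq uv => ->; rewrite adj_irrefl.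
  pose c : contract uv := Sub u uNv.
  pose phi x : option (contract uv) := if x == v then Some c else insub x.
  have phi_val (h : contract uv) : phi (val h) = Some h.
    by rewrite /phi (negbTE (valP h)) valK.
  have phi_v : phi v = Some c by rewrite /phi eqxx.
  (* Hence only [c] has two preimages, the adjacent vertices [u] and [v]. *)
  have phiE x h : phi x = Some h -> x = val h \/ x = v /\ h = c.
    rewrite /phi; case: eqVneq => [-> [<-]|xNv]; first by right.
    by case: insubP => // a _ <- [->]; left.
  exists phi; split.
  + by move=> h; exists (val h).
  + move=> h h' /andP[_ /or3P[hh'|/andP[/eqP hu vh']|/andP[/eqP hu vh]]].
    * by exists (val h), (val h').
    * by exists v, (val h'); split; rewrite ?phi_v //; congr Some; apply/val_inj.
    * exists (val h), v; split; rewrite ?phi_v // 1?adj_sym //.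
      by congr Some; apply/val_inj.
  + move=> x y h xNy /phiE xE /phiE yE; suff -> : h = c.
      by exists u, v; rewrite phi_v; split=> //; apply: phi_val c.
    case: xE yE => [xE [yE|[_ //]]|[_ //]].
    by rewrite xE yE eqxx in xNy.
Qed.

Lemma model_minor (G H : sgraph) : minor H G -> exists phi : G -> option H, model phi.
Proof.
case=> H' GH' HH'; elim: GH' HH' => [G'|G' G1 G2 step _ IH] iso.
  exact: model_giso.
have [psi psiP] := IH iso; have [phi phiP] := model_minor_step step.
by exists (fun x => obind psi (phi x)); apply: model_comp.
Qed.

(** * Dense minors of regular graphs *)

Section ModelInRegularGraph.

Variables (k : nat) (G H : sgraph) (phi : G -> option H).
Hypotheses (regG : regular k.+1 G) (phiP : model phi).
Hypothesis degH : forall h : H, k < deg h.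

(** The first conjunct excludes a vertex that is the only deleted one. *)
Definition lone : {set G} :=
  [set x | (phi x != None) && [forall y, (phi y == phi x) ==> (y == x)]].

Lemma lone_inj x y : x \in lone -> phi y = phi x -> y = x.
Proof. by rewrite inE => /andP[_ /forallP/(_ y)/implyP h] /eqP/h/eqP. Qed.

(** As [x] is the only preimage of [h], every neighbour of [h] is the image of a neighbour of [x].
    Since [deg h >= k + 1 = deg x], there is no room for a collision or a deleted neighbour. *)
Lemma lone_nbhd x h : x \in lone -> phi x = Some h ->
  phi @: [set y | adj x y] = Some @: [set h' | adj h h'] /\
  {in [set y | adj x y] &, injective phi}.
Proof.
move=> lx phix.
have sub : Some @: [set h' | adj h h'] \subset phi @: [set y | adj x y].
  apply/subsetP=> _ /imsetP[h' hh' ->]; rewrite inE in hh'.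
  have [x' [y [phix' phiy x'y]]] := model_adj phiP hh'.
  rewrite -phiy; apply: imset_f; rewrite inE.
  by rewrite -(lone_inj lx (y := x')) // phix' phix.
have cardN : #|[set y | adj x y]| = k.+1 by exact: regG.
have cardS : k.+1 <= #|Some @: [set h' | adj h h']|.
  by rewrite card_imset; [exact: degH | move=> ? ? []].
have le1 := leq_imset_card phi (mem [set y | adj x y]).
have le2 := subset_leq_card sub.
split; last by apply/imset_injP; rewrite eqn_leq le1 cardN (leq_trans cardS).
apply/esym/eqP; rewrite eqEcard sub (leq_trans le1) //.
by rewrite -[X in X <= _]/#|[set y | adj x y]| cardN.
Qed.

(** A one-vertex branch set counts twice on the right, once in [G] and once in [lone], so each [h]
    receives at least 2. *)
Lemma card_lone : 2 * #|H| <= #|G| + #|lone|.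
Proof.
pose fib h := [set x | phi x == Some h].
have fib_ge2 h : 2 <= #|fib h| + #|lone :&: fib h|.
  have [x phix] := model_surj phiP h.
  have xf : x \in fib h by rewrite inE phix.
  have [lx|] := boolP (x \in lone).
    have c1 : 0 < #|fib h| by apply/card_gt0P; exists x.
    have c2 : 0 < #|lone :&: fib h| by apply/card_gt0P; exists x; rewrite inE lx.
    exact: (leq_add c1 c2).
  rewrite inE phix /= => /forallPn[y]; rewrite negb_imply => /andP[phiy yNx].
  apply: leq_trans (leq_addr _ _).
  have <- : #|[set x; y]| = 2 by rewrite cards2 eq_sym yNx.
  by apply/subset_leq_card/subsetP=> z /set2P[]->; rewrite // inE.
(* Each vertex of [A] lies in at most one fibre. *)
have sum_fib (A : {set G}) : \sum_h #|A :&: fib h| <= #|A|.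
  have fibE h : #|A :&: fib h| = \sum_(x in A) (phi x == Some h).
    rewrite -sum1_card big_mkcond [RHS]big_mkcond; apply: eq_bigr => x _.
    by rewrite !inE; case: (x \in A) => //=; case: eqP.
  under eq_bigr do rewrite fibE.
  rewrite exchange_big -[X in _ <= X]sum1_card; apply: leq_sum => x _ /=.
  case: (phi x) => [h|]; last by rewrite big1.
  rewrite (bigD1 h) //= eqxx big1 // => h' h'Nh.
  by rewrite (inj_eq Some_inj) eq_sym (negPf h'Nh).
have := leq_add (sum_fib setT) (sum_fib lone).
rewrite -big_split /= cardsT; apply: leq_trans.
rewrite mulnC -sum_nat_const; apply: leq_sum => h _.
by rewrite setTI.
Qed.

(** Inclusion-exclusion for two neighbourhoods of size [k + 1]. *)
Lemma card_common_nbhd (u v : G) : adj u v ->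
  2 * k.+1 <= #|G| + #|[set w | adj u w && adj v w]|.
Proof.
move=> uv; have := cardsUI [set w | adj u w] [set w | adj v w].
rewrite (_ : _ :&: _ = [set w | adj u w && adj v w]); last first.
  by apply/setP=> w; rewrite !inE.
rewrite -!/(deg _) !regG mul2n -addnn => <-.
by rewrite leq_add2r max_card.
Qed.

Lemma model_branch_card (x y : G) h :
  x != y -> phi x = Some h -> phi y = Some h -> 4 * (k + 2) <= 3 * #|G|.
Proof.
move=> xNy phix phiy.
have [u [v [phiu phiv uv]]] := model_branch phiP xNy phix phiy.
have uNv : u != v by apply: contraTneq uv => ->; rewrite adj_irrefl.
pose C := [set w | adj u w && adj v w].
have uvC : [disjoint [set u; v] & C].
  rewrite disjoint_subset; apply/subsetP=> z /set2P[]->; rewrite !inE.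
    by rewrite adj_irrefl.
  by rewrite adj_irrefl andbF.
(* [u] and [v] share a branch set, whereas [phi] is injective on the neighbourhood of a lone vertex,
   which therefore cannot contain both. *)
have sub : [set u; v] :|: C \subset ~: lone.
  apply/subsetP=> z; rewrite in_setC => /setUP[/set2P[]->|].
  - by apply/negP=> /lone_inj/(_ (etrans phiv (esym phiu)))/eqP; rewrite eq_sym (negPf uNv).
  - by apply/negP=> /lone_inj/(_ (etrans phiu (esym phiv)))/eqP; rewrite (negPf uNv).
  rewrite inE => /andP[uz vz]; apply/negP=> lz.
  have [h' phiz] : exists h', phi z = Some h'.
    by move: lz; rewrite inE; case: (phi z) => [h' _|//]; exists h'.
  have [_ inj] := lone_nbhd lz phiz.
  have := inj u v; rewrite !inE ![adj z _]adj_sym uz vz phiu phiv.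
  by move=> /(_ isT isT erefl)/eqP; rewrite (negPf uNv).
(* With [n = #|G|], combine [2 + #|C| <= n - #|lone|], [#|C| >= 2 * (k + 1) - n] and
   [#|lone| >= 2 * (k + 2) - n]. *)
have := subset_leq_card sub.
rewrite cardsU (disjoint_setI0 uvC) cards0 subn0 cards2 uNv.
have /card_gt0P[h0 _] := vertex_nonempty H.
have Hk : k.+1 < #|H| := leq_ltn_trans (degH h0) (deg_lt_card h0).
have cC : 2 * k.+1 <= #|G| + #|C| := card_common_nbhd uv.
have cl : 2 * #|H| <= #|G| + #|lone| := card_lone.
have cG : #|lone| + #|~: lone| = #|G| := cardsC lone.
lia.
Qed.

Lemma model_giso_small : 3 * #|G| < 4 * (k + 2) -> giso G H.
Proof.
move=> small.
have phi_inj x y h : phi x = Some h -> phi y = Some h -> x = y.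
  move=> phix phiy; apply/eqP; apply: contraTT small => xNy.
  by rewrite -leqNgt; apply: model_branch_card xNy phix phiy.
have loneE x h : phi x = Some h -> x \in lone.
  move=> phix; rewrite inE phix; apply/forallP=> y; apply/implyP=> /eqP phiy.
  by apply/eqP; apply: phi_inj phiy phix.
(* The set of undeleted vertices is closed under taking neighbours. *)
have nbhd_def x h y : phi x = Some h -> adj x y -> exists2 h', phi y = Some h' & adj h h'.
  move=> phix xy; have [E _] := lone_nbhd (loneE _ _ phix) phix.
  have : phi y \in phi @: [set y | adj x y] by rewrite imset_f ?inE.
  by rewrite E => /imsetP[h' hh' ->]; exists h'; rewrite ?inE // in hh' *.
have /card_gt0P[h0 _] := vertex_nonempty H.
have [x0 phix0] := model_surj phiP h0.
have total y : exists h, phi y == Some h.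
  case phiy: (phi y) => [h|]; first by exists h.
  (* The closed neighbourhoods of an undeleted [x0] and a deleted [y] would be disjoint, forcing
     [2 * (k + 2) <= #|G|]. *)
  pose N (z : G) := z |: [set w | adj z w].
  have cardN z : #|N z| = k.+2 by rewrite cardsU1 inE adj_irrefl -/(deg z) regG.
  have: N x0 :&: N y = set0.
    apply/setP=> z; rewrite in_set0; apply/negP; rewrite !inE.
    case/andP=> /orP x0z yz.
    have [h phiz] : exists h, phi z = Some h.
      by case: x0z => [/eqP->|/(nbhd_def _ _ _ phix0)[h]]; [exists h0 | exists h].
    case/orP: yz => [/eqP zE|yz]; first by rewrite zE phiy in phiz.
    rewrite adj_sym in yz; have [h'] := nbhd_def _ _ _ phiz yz.
    by rewrite phiy.
  move=> disj; have := max_card (mem (N x0 :|: N y)).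
  rewrite cardsU disj cards0 !cardN.
  by have := small; lia.
pose f x := xchoose (total x).
have fE x : phi x = Some (f x) by apply/eqP/(xchooseP (total x)).
have f_inj : injective f by move=> x y eq_f; apply: phi_inj (fE x) _; rewrite eq_f.
have f_surj h : exists x, f x = h.
  by have [x phix] := model_surj phiP h; exists x; move: phix; rewrite fE => -[].
exists f.
  apply: inj_card_bij => //; rewrite -(card_codom f_inj).
  by apply/subset_leq_card/subsetP=> h _; have [x <-] := f_surj h; apply: codom_f.
move=> x y; apply/idP/idP=> [|xy].
  case/(model_adj phiP) => a [b [phia phib ab]].
  by rewrite (phi_inj _ _ _ (fE x) phia) (phi_inj _ _ _ (fE y) phib).
by have [h'] := nbhd_def _ _ _ (fE x) xy; rewrite fE => -[->].
Qed.

End ModelInRegularGraph.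

(** * Minimality of small regular graphs *)

Lemma minor_refl (G : sgraph) : minor G G.
Proof. by exists G; [exact: rt1n_refl | exists id; [exists id |]]. Qed.

Lemma model_section (G H : sgraph) (phi : G -> option H) : model phi ->
  exists2 g : H -> G, injective g & forall h, phi (g h) = Some h.
Proof.
case=> surj _ _; have ex h : exists x, phi x == Some h.
  by have [x /eqP] := surj h; exists x.
pose g h := xchoose (ex h).
have gE h : phi (g h) = Some h by apply/eqP/(xchooseP (ex h)).
by exists g => // h h' eq_g; apply: Some_inj; rewrite -!gE eq_g.
Qed.

Lemma model_leq_card (G H : sgraph) (phi : G -> option H) : model phi -> #|H| <= #|G|.
Proof. by case/model_section=> g g_inj _; apply: leq_card g_inj. Qed.

(** [phi] is then a bijection that makes [H] a spanning subgraph of [G], so lower bounds on degrees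
    pass from [H] up to [G]. *)
Lemma model_spanning_deg (G H : sgraph) (phi : G -> option H) :
  model phi -> #|G| <= #|H| -> forall x : G, exists h : H, deg h <= deg x.
Proof.
move=> phiP leGH x; have [g g_inj gE] := model_section phiP.
have [g' _ gK] := inj_card_bij g_inj leGH.
have phiE y h : phi y = Some h -> y = g h by rewrite -{1}(gK y) gE => -[<-].
exists (g' x); rewrite /deg -(card_imset _ g_inj).
apply/subset_leq_card/subsetP=> _ /imsetP[h xh ->].
rewrite !inE in xh *; have [a [b [/phiE-> /phiE->]]] := model_adj phiP xh.
by rewrite gK.
Qed.

Lemma giso_card (G H : sgraph) : giso G H -> #|G| = #|H|.
Proof. by case=> f /bij_eq_card. Qed.

Lemma regular_minimal_forbidden (k : nat) (G : sgraph) :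
  regular k.+1 G -> 3 * #|G| < 4 * (k + 2) -> minimal_forbidden k G.
Proof.
move=> regG small; split.
  move=> /(_ G (minor_refl G)); rewrite leqNgt => /negP; apply.
  by apply: leq_min_deg => x; rewrite regG.
move=> H [HG HNG] K KH; have [phi phiP] := model_minor HG.
have [psi psiP] := model_minor KH.
(* A minor [K] of [H] with minimum degree above [k] is isomorphic to [G], so [H] has no more
   vertices than [K]. The degrees of [H] then exceed [k] too, and [H] itself is isomorphic to
   [G]. *)
rewrite leqNgt; apply/negP => lt_k.
have degK (z : K) : k < deg z by apply: leq_trans lt_k (min_deg_leq z).
have GK : giso G K := model_giso_small regG (model_comp phiP psiP) degK small.
have leHK : #|H| <= #|K| by rewrite -(giso_card GK) (model_leq_card phiP).
have degH (h : H) : k < deg h.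
  have [z] := model_spanning_deg psiP leHK h.
  exact: leq_trans (degK z).
exact/HNG/giso_sym/(model_giso_small regG phiP degH small).
Qed.

(** * Clique contractions *)

(** Induction on [#|G|]: contracting an edge inside a fibre keeps the fibres cliques, and once [phi]
    is injective it is an isomorphism. *)
Lemma contract_cliques (G H : sgraph) (phi : G -> H) :
    (forall h, exists x, phi x = h) ->
    (forall x y, adj x y -> phi x != phi y -> adj (phi x) (phi y)) ->
    (forall h h', adj h h' -> exists x y, [/\ phi x = h, phi y = h' & adj x y]) ->
    (forall x y, x != y -> phi x = phi y -> adj x y) ->
  minor H G.
Proof.
have [n] := ubnP #|G|; elim: n => // n IH in G phi *.
rewrite ltnS => leGn surj hom adjH clique.
have [inj|] := boolP (injectiveb phi).
  exists G; first exact: rt1n_refl.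
  apply: giso_sym; exists phi.
    apply: inj_card_bij; first exact/injectiveP.
    rewrite -(card_codom (injectiveP _ inj)).
    by apply/subset_leq_card/subsetP=> h _; have [x <-] := surj h; apply: codom_f.
  move=> x y; apply/idP/idP=> [/adjH[a [b]]|xy].
    by case=> /(injectiveP _ inj)-> /(injectiveP _ inj)->.
  apply: hom => //; rewrite (inj_eq (injectiveP _ inj)).
  by apply: contraTneq xy => ->; rewrite adj_irrefl.
case/injectivePn=> u [v uNv phi_uv]; have uv := clique _ _ uNv phi_uv.
pose phi' (x : contract uv) := phi (val x).
(* The retraction that sends [v] to [u]: the default of [insubd] is taken only at [v]. *)
pose r x : contract uv := insubd (Sub u uNv) x.
have valr x : val (r x) = if x != v then x else u by rewrite val_insubd SubK.
have phir x : phi' (r x) = phi x.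
  by rewrite /phi' valr; case: eqVneq => // ->.
have adjr x y : adj x y -> r x != r y -> adj (r x) (r y).
  move=> xy rNr; rewrite /adj /= /contract_adj rNr !valr /=.
  have [xv|_] := eqVneq x v; have [yv|_] /= := eqVneq y v.
  - by rewrite xv yv adj_irrefl in xy.
  - by rewrite -xv eqxx xy orbT.
  - by rewrite -yv eqxx (adj_sym y x) xy !orbT.
  - by rewrite xy.
have [H' step iso] : minor H (contract uv).
  apply: (IH _ phi').
  - apply: leq_trans leGn.
    by rewrite card_sig cardC1 ltn_predL; apply/card_gt0P; exists u.
  - by move=> h; have [x <-] := surj h; exists (r x).
  - move=> x y /andP[_ /or3P[xy|/andP[/eqP xu vy]|/andP[/eqP yu vx]]] neq.
    + exact: hom.
    + by rewrite /phi' xu phi_uv in neq *; apply: hom.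
    + by rewrite /phi' yu phi_uv adj_sym eq_sym in neq *; apply: hom.
  - move=> h h' hh'; have hNh' : h != h'.
      by apply: contraTneq hh' => ->; rewrite adj_irrefl.
    have [x [y [phix phiy xy]]] := adjH _ _ hh'.
    exists (r x), (r y); rewrite !phir; split=> //; apply: adjr => //.
    by apply: contraNneq hNh' => /(congr1 phi'); rewrite !phir phix phiy => ->.
  - move=> x y xNy eq_phi; rewrite /adj /= /contract_adj xNy /=.
    by rewrite (clique _ _ _ eq_phi) // val_eqE.
by exists H' => //; apply: rt1n_trans step; apply: StepContract.
Qed.

(** * The extremal graph and its complete minor *)

Definition complete_adj (T : finType) : rel T := fun x y => x != y.

Lemma complete_sym (T : finType) : symmetric (@complete_adj T).
Proof. by move=> x y; rewrite /complete_adj eq_sym. Qed.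

Lemma complete_irrefl (T : finType) : irreflexive (@complete_adj T).
Proof. by move=> x; rewrite /complete_adj eqxx. Qed.

Section Extremal.

Variable p : nat.

(* Blow-up of C_4: the four parts are indexed by bool * bool, and only parts
   differing exactly in the second coordinate are not joined. *)
Definition blowup_adj : rel ('I_p.+1 * (bool * bool)) :=
  fun x y => (x != y) && ~~ ((x.2.1 == y.2.1) && (x.2.2 != y.2.2)).

Lemma blowup_sym : symmetric blowup_adj.
Proof.
by move=> x y; rewrite /blowup_adj eq_sym (eq_sym x.2.1) (eq_sym x.2.2).
Qed.

Lemma blowup_irrefl : irreflexive blowup_adj.
Proof. by move=> x; rewrite /blowup_adj eqxx. Qed.

Lemma blowup_nonempty : 0 < #|{: 'I_p.+1 * (bool * bool)}|.
Proof. by rewrite !card_prod card_ord card_bool. Qed.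

Definition blowup : sgraph := SGraph blowup_sym blowup_irrefl blowup_nonempty.

Lemma triple_nonempty : 0 < #|{: 'I_p.+1 * option bool}|.
Proof. by rewrite card_prod card_ord card_option card_bool. Qed.

Definition complete3 : sgraph :=
  SGraph (@complete_sym ('I_p.+1 * option bool)%type)
         (@complete_irrefl ('I_p.+1 * option bool)%type) triple_nonempty.

Lemma card_blowup : #|blowup| = 4 * p.+1.
Proof. by rewrite /= !card_prod card_ord card_bool mulnC. Qed.

Lemma card_complete3 : #|complete3| = 3 * p.+1.
Proof. by rewrite /= card_prod card_ord card_option card_bool mulnC. Qed.

(** The non-neighbours of a vertex are itself and the [p + 1] vertices of the opposite part [P],
    which leaves [4 * (p + 1) - (p + 2)]. *)
Lemma blowup_regular : regular (3 * p + 2) blowup.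
Proof.
case=> i [b c]; rewrite /deg.
pose x : blowup := (i, (b, c)).
pose P : {set blowup} := [set (j, (b, ~~ c)) | j in 'I_p.+1].
have cardP : #|P| = p.+1 by rewrite card_imset ?card_ord // => j j' [].
have xNP : x \notin P.
  by apply/negP=> /imsetP[j _ /(congr1 (fun y : blowup => y.2.2))] /=; case: (c).
have -> : [set y | @adj blowup (i, (b, c)) y] = ~: (x |: P).
  apply/setP=> -[j [b' c']]; rewrite !inE negb_or /adj /= /blowup_adj eq_sym /=.
  congr (_ && ~~ _); apply/andP/imsetP => [[/eqP<- cNc']|[j' _ [_ -> ->]]].
    by exists j => //; case: (c) (c') cNc' => -[].
  by rewrite eqxx; case: (c).
have := cardsC (x |: P); rewrite cardsU1 xNP cardP card_blowup.
lia.
Qed.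

Lemma complete3_deg (h : complete3) : deg h = 3 * p + 2.
Proof.
have := cardsC1 h; rewrite card_complete3 => cardC1.
have -> : 3 * p + 2 = #|[set~ h]| by rewrite cardC1; lia.
by apply: eq_card => h'; rewrite !inE eq_sym.
Qed.

Lemma complete3_minor : minor complete3 blowup.
Proof.
(* The two parts with last coordinate [true] are kept; [(i, (true, false))] and
   [(i, (false, false))] merge into [(i, None)]. *)
pose phi (x : blowup) : complete3 := (x.1, if x.2.2 then Some x.2.1 else None).
apply: (@contract_cliques _ _ phi).
- case=> i [b|]; first by exists (i, (b, true)).
  by exists (i, (true, false)).
- by move=> x y _.
- case=> i o [j o'] hh'.
  pose lift (h : complete3) b : blowup :=
    (h.1, if h.2 is Some b' then (b', true) else (b, false)).
  have phi_lift h b : phi (lift h b) = h by case: h => [? [?|]].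
  (* [(i, None)] has a preimage for either value of the first boolean; [c] avoids the value of an
     endpoint [Some b], so the lifts never lie in opposite parts. *)
  pose c := if o is Some b then ~~ b else if o' is Some b then ~~ b else true.
  exists (lift (i, o) c), (lift (j, o') c); rewrite !phi_lift; split=> //.
  rewrite /adj /= /blowup_adj; apply/andP; split.
    by apply: contraTneq hh' => /(congr1 phi); rewrite !phi_lift => ->; rewrite adj_irrefl.
  rewrite /lift /c /=; case: (o) (o') => [[]|] [[]|] //=.
- move=> [i [b c]] [j [b' c']] xNy [ij]; rewrite /adj /= /blowup_adj xNy /=.
  by move: xNy; rewrite ij; case: b b' c c' => -[] [] [] //=; rewrite eqxx.
Qed.

End Extremal.

Theorem theorem1p1 :
  (forall (k : nat) (G : sgraph),
      regular k.+1 G -> 3 * #|G| < 4 * (k + 2) -> minimal_forbidden k G) /\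
  (forall k : nat, k = 1 %[mod 3] ->
      exists G : sgraph,
        [/\ regular k.+1 G, 3 * #|G| = 4 * (k + 2) & ~ minimal_forbidden k G]).
Proof.
split; first exact: regular_minimal_forbidden.
(* The parts have size [p + 1], and [k + 2 = 3 * (p + 1)]. *)
move=> k k_mod; pose p := k %/ 3; have kE : k.+1 = 3 * p + 2 by rewrite /p; lia.
exists (blowup p); split; first by rewrite kE; apply: blowup_regular.
  by rewrite card_blowup; lia.
(* The complete minor is proper, having fewer vertices, yet all its degrees are [k + 1]. *)
case=> _ /(_ (complete3 p)) minD.
have: classD k (complete3 p).
  apply: minD; split; first exact: complete3_minor.
  by move=> /giso_card; rewrite card_blowup card_complete3; lia.
move=> /(_ _ (minor_refl _)); rewrite leqNgt => /negP; apply.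
by apply: leq_min_deg => h; rewrite complete3_deg kE.
Qed.
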